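(* Let $n$ be a positive odd integer and let $\alpha$ be a positive even integer with $\alpha\le n$. Then $$\sum_{k=0}^{n-1}q^{\binom{k+1}{2}}{\alpha+k-1 \brack k}_q{\alpha+n-1 \brack n-1-k}_q\equiv 2[n](1-q)+\frac{2q^{\alpha}[n]-[\alpha]}{[\alpha]}-2[n]\,Q_n(2,q)-2[n]\sum_{k=1}^{\alpha}\frac{(-1)^k}{[k]}\pmod{\Phi_n(q)^2}.$$ Furthermore, $$\sum_{j=0}^{n-1}q^j\sum_{k=0}^{j}q^{\binom{k+1}{2}}{\alpha+k-1 \brack k}_q{\alpha+n-1 \brack n-1-k}_q\equiv -[n]-\frac{[\alpha]-[n]}{q^{\alpha}}-\frac{2[\alpha][n]}{q^{\alpha}}Q_n(2,q)-\frac{2[\alpha][n]}{q^{\alpha}}\sum_{k=1}^{\alpha}\frac{(-q)^k}{[k]}\pmod{\Phi_n(q)^2}.$$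
   Context: Here $q$ is an indeterminate. The $q$-shifted factorial is $(a;q)_m=(1-a)(1-aq)\cdots(1-aq^{m-1})$, with $(a;q)_0=1$. The $q$-integer is $[m]=[m]_q=\frac{1-q^m}{1-q}=1+q+\cdots+q^{m-1}$. The $q$-binomial coefficient is ${m\brack k}_q=\frac{(q;q)_m}{(q;q)_k(q;q)_{m-k}}$ if $0\le k\le m$, and $0$ otherwise. $\Phi_n(q)=\prod_{1\le k\le n,\ \gcd(k,n)=1}(q-\zeta^k)$, with $\zeta$ a primitive $n$th root of unity, is the $n$-th cyclotomic polynomial. The $q$-Fermat quotient is the rational function $$Q_n(m,q)=\frac{(q^m;q^m)_{n-1}/(q;q)_{n-1}-1}{[n]}.$$ Congruences are between rational functions in $q$: for polynomials $A(q),B(q),C(q)\in\mathbb{Z}[q]$, the congruence $A(q)/B(q)\equiv 0\pmod{C(q)}$ means that $A(q)$ is divisible by $C(q)$ and $B(q)$ is coprime to $C(q)$ (the rational function being written in such a form, e.g. in lowest terms); and two rational functions are congruent modulo $C(q)$ if their difference is congruent to $0$ modulo $C(q)$. *)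

(* Defs.v *)
From HB Require Import structures.
From mathcomp Require Import all_boot all_order all_algebra all_field.

Set Implicit Arguments.
Unset Strict Implicit.
Unset Printing Implicit Defensive.

Import GRing.Theory.
Local Open Scope ring_scope.

Section QAnalogues.

Variables (K : fieldType).
Implicit Types (a q : K) (m k n : nat).

Definition qpoch a q m : K := \prod_(i < m) (1 - a * q ^+ i).

(* Only meaningful for q != 1, as x / 0 = 0. *)
Definition qint q m : K := (1 - q ^+ m) / (1 - q).

(* The Gaussian binomial, only when q is not a root of unity. *)
Definition qbinom q m k : K :=
  if (k <= m)%N then qpoch q q m / (qpoch q q k * qpoch q q (m - k)) else 0.

Definition qfermat n m q : K :=
  (qpoch (q ^+ m) (q ^+ m) (n - 1) / qpoch q q (n - 1) - 1) / qint q n.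

End QAnalogues.

(* Q(q), as the fraction field of Z[q]. *)
Definition ratfun := {fraction {poly int}}.

Definition polyfrac (A : {poly int}) : ratfun := @FracField.tofrac {poly int} A.

Definition qX : ratfun := polyfrac 'X.

(* Divisibility in Z[q]; over int, the library's %| on polynomials is
   pseudo-divisibility, which is only divisibility up to an integer factor. *)
Definition zdvd (D A : {poly int}) : Prop := exists E, A = E * D.

(* Coprimality in Z[q]; over int, the library's coprimep ignores the common
   divisors of degree 0. *)
Definition zcoprime (B C : {poly int}) : Prop :=
  forall D, zdvd D B -> zdvd D C -> D \is a GRing.unit.

Definition ratfun_eq0_mod (C : {poly int}) (x : ratfun) : Prop :=
  exists A B : {poly int},
    [/\ B != 0, x = polyfrac A / polyfrac B, zdvd C A & zcoprime B C].

Definition ratfun_eq_mod (C : {poly int}) (x y : ratfun) : Prop :=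
  ratfun_eq0_mod C (x - y).

(* Main.v *)
Require Import Defs.
From mathcomp Require Import all_boot all_order all_algebra all_field.
From mathcomp Require Import ring zify.

(** Write a = alpha - 1 (odd) and e = 1 - q^n, which is divisible by Phi_n.
    The factorials in the k-th summand t_k rearrange exactly into
      t_k = e [n+a, a] (q^C(k+1,2) [n-1, k]) / (1 - q^(alpha+k)),
    see [summand_factored].  Modulo Phi_n one has q^n = 1, whence
      q^C(k+1,2) [n-1, k] = (-1)^k   and   [n+a, a] = 1
    ([cong_qbinom_pred], [cong_qbinom_add]).  As t_k carries the factor e, this
    gives t_k = e (-1)^k / (1 - q^(alpha+k)) modulo Phi_n^2, except for the one
    index k = n - alpha at which the denominator is e as well.  There t_k is a
    unit, q^C(n-a,2) [n+a, a] [n-1, a], and it is the factors 1 - q^(n-i) and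
    1 - q^(n+i) taken in pairs that determine it modulo Phi_n^2: it equals
    - q^C(n,2) ([cong_exceptional]).

    In the sum over k, the indices alpha + k run through alpha, ..., n + a
    without n; folding those above n back by n with a change of sign turns the
    sum into sum_(1 <= k < n) - 2 sum_(1 <= k < alpha) of h_k, where
    h_k = (-1)^k / (1 - q^k) ([cong_sum1]).  The complete sum of the h_k is a
    q-Fermat quotient in disguise: expanding (-1; q)_n = 2 (-q; q)_(n-1) by the
    q-binomial theorem gives
      2 (-q; q)_(n-1) = 1 + q^C(n,2) - e sum_(1 <= k < n) h_k  mod Phi_n^2
    ([cong_fermat]), while [n] Q_n(2, q) is exactly (-q; q)_(n-1) - 1
    ([qint_fermat]).  The terms q^C(n,2) cancel, and the first congruence
    follows ([cong_sum1_qpoch]).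

    For the second, summation by parts rewrites the double sum S2 through
    sum_k q^k t_k and S1 = sum_k t_k.  As q^(alpha+k) t_k differs from t_k by
    e [n+a, a] q^C(k+1,2) [n-1, k], one more use of the q-binomial theorem gives
      q^alpha (1 - q) S2 = (1 - q^(n+alpha)) S1 - e [n+a, a] (-q; q)_(n-1)
    exactly ([sum2E]), so that S2 is known modulo Phi_n^2 once S1 is.

    Congruences of rational functions are handled in the ring of the fractions
    that are regular at all primitive n-th roots of unity.  Only a few closure
    properties of the powers of Phi_n in it matter; they are collected in
    [cyclotomic_filtration], and the computation takes place in any field with
    such a filtration. *)

Set Implicit Arguments.
Unset Strict Implicit.
Unset Printing Implicit Defensive.

Import GRing.Theory.
Local Open Scope ring_scope.

(** * Exact identities for Gaussian binomials *)

Lemma qpochS (K : fieldType) (a q : K) m :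
  qpoch a q m.+1 = qpoch a q m * (1 - a * q ^+ m).
Proof. by rewrite /qpoch big_ord_recr. Qed.

Section ExactIdentities.
Variables (K : fieldType) (q : K).
Hypothesis q_nonroot : forall m, (0 < m)%N -> 1 - q ^+ m != 0.

Lemma qpoch_qS m : qpoch q q m.+1 = qpoch q q m * (1 - q ^+ m.+1).
Proof. by rewrite qpochS exprS. Qed.

Lemma qpoch_neq0 m : qpoch q q m != 0.
Proof.
elim: m => [|m IHm]; first by rewrite /qpoch big_ord0 oner_eq0.
by rewrite qpoch_qS mulf_neq0 ?q_nonroot.
Qed.

Lemma qbinom0 m : qbinom q m 0 = 1.
Proof.
rewrite /qbinom /= subn0 [qpoch q q 0]/qpoch big_ord0 mul1r divff //.
exact: qpoch_neq0.
Qed.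

Lemma qbinomn m : qbinom q m m = 1.
Proof.
rewrite /qbinom leqnn subnn [qpoch q q 0]/qpoch big_ord0 mulr1 divff //.
exact: qpoch_neq0.
Qed.

Lemma qbinom_sym m k : (k <= m)%N -> qbinom q m (m - k) = qbinom q m k.
Proof.
by move=> le_km; rewrite /qbinom leq_subr le_km subKn // [qpoch q q k * _]mulrC.
Qed.

Lemma mul_qbinomSr m k : (k <= m)%N ->
  qbinom q m k.+1 * (1 - q ^+ k.+1) = qbinom q m k * (1 - q ^+ (m - k)).
Proof.
rewrite leq_eqVlt => /predU1P[-> | lt_km].
  by rewrite /qbinom ltnn subnn expr0 subrr mul0r mulr0.
rewrite /qbinom lt_km ltnW // -(subnSK lt_km) !qpoch_qS subnSK //.
have := qpoch_neq0 k; have := qpoch_neq0 (m - k.+1).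
have := q_nonroot (ltn0Sn k).
have: 1 - q ^+ (m - k) != 0 by rewrite q_nonroot ?subn_gt0.
move: (1 - q ^+ (m - k)) (1 - q ^+ k.+1) => u v u0 v0 p0 r0.
by field; rewrite u0 v0 p0 r0.
Qed.

Lemma mul_qbinomSS m k : (k <= m)%N ->
  qbinom q m.+1 k.+1 * (1 - q ^+ k.+1) = qbinom q m k * (1 - q ^+ m.+1).
Proof.
move=> le_km; rewrite /qbinom ltnS le_km subSS !qpoch_qS.
have := qpoch_neq0 k; have := qpoch_neq0 (m - k).
have := q_nonroot (ltn0Sn k).
move: (1 - q ^+ m.+1) (1 - q ^+ k.+1) => u v v0 p0 r0.
by field; rewrite v0 p0 r0.
Qed.

(** Pascal's rule; it holds for k = m too, where the first term is 0. *)
Lemma qbinomS m k : (k <= m)%N ->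
  qbinom q m.+1 k.+1 = qbinom q m k.+1 + q ^+ (m - k) * qbinom q m k.
Proof.
move=> le_km; apply: (mulIf (q_nonroot (ltn0Sn k))).
rewrite mulrDl mul_qbinomSS // mul_qbinomSr // -{2}(subnK le_km) -addnS exprD.
by ring.
Qed.

Lemma qbinomial_theorem N (x : K) :
  \sum_(0 <= k < N.+1) q ^+ 'C(k, 2) * x ^+ k * qbinom q N k = qpoch (- x) q N.
Proof.
elim: N => [|N IHN].
  by rewrite big_nat1 qbinom0 /qpoch big_ord0 !mulr1.
rewrite qpochS -IHN mulNr opprK mulrDr mulr1 big_nat_recl //.
under eq_big_nat => k /andP[_ le_kN] do rewrite qbinomS // mulrDr.
rewrite big_split addrA; congr (_ + _) => /=.
  rewrite [RHS]big_nat_recl // !qbinom0 [in LHS]big_nat_recr //=.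
  by rewrite [qbinom q N N.+1]/qbinom ltnn mulr0 addr0.
rewrite mulr_suml; apply: eq_big_nat => k /andP[_]; rewrite ltnS => le_kN.
have ->: q ^+ N = q ^+ (N - k) * q ^+ k by rewrite -exprD subnK.
rewrite binS bin1 exprD exprS; ring.
Qed.

Lemma qpoch_sqr m : qpoch (q ^+ 2) (q ^+ 2) m / qpoch q q m = qpoch (- q) q m.
Proof.
apply: (mulIf (qpoch_neq0 m)); rewrite divfK ?qpoch_neq0 //.
rewrite /qpoch -big_split; apply: eq_bigr => i _ /=.
by rewrite exprAC; ring.
Qed.

Lemma qint_fermat n : (0 < n)%N ->
  qint q n * qfermat n 2 q = qpoch (- q) q (n - 1) - 1.
Proof.
move=> n_gt0; rewrite /qfermat qpoch_sqr mulrC divfK //.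
rewrite /qint mulf_neq0 ?q_nonroot //.
by rewrite invr_neq0 // -(expr1 q) q_nonroot.
Qed.

(** The factor 1 + q^0 is what makes the 2 appear. *)
Lemma qpoch_N1 n : (0 < n)%N -> qpoch (- 1) q n = 2 * qpoch (- q) q (n - 1).
Proof.
case: n => // n _; rewrite subn1 /qpoch big_ord_recl mulN1r expr0 opprK.
by congr (_ * _); apply: eq_bigr => i _; rewrite /= exprS; ring.
Qed.

(** Of the factorials that involve both a and k, only the quotient of (q; q)_(a+k)
    by (q; q)_(a+k+1) survives: it is the denominator on the right. *)
Lemma qbinom_mul_factored n a k : (k < n)%N ->
  qbinom q (a + k) k * qbinom q (a + n) (n - 1 - k) =
    (1 - q ^+ n) * qbinom q (n + a) a * (qbinom q (n - 1) k / (1 - q ^+ (a.+1 + k))).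
Proof.
case: n => // n; rewrite ltnS => le_kn.
have ->: (a + n.+1 = (n + a).+1)%N by lia.
rewrite subSS subn0 /qbinom leq_addl addnK.
have ->: (n - k <= (n + a).+1)%N by lia.
have ->: ((n + a).+1 - (n - k) = (a + k).+1)%N by lia.
rewrite le_kn addSn leqW ?leq_addl //.
have ->: ((n + a).+1 - a = n.+1)%N by lia.
rewrite addSn [qpoch q q (a + k).+1]qpoch_qS [qpoch q q n.+1]qpoch_qS.
have := qpoch_neq0 k; have := qpoch_neq0 (n - k); have := qpoch_neq0 a.
have := qpoch_neq0 n; have := qpoch_neq0 (a + k).
have := q_nonroot (ltn0Sn (a + k)); have := q_nonroot (ltn0Sn n).
move: (1 - q ^+ n.+1) (1 - q ^+ (a + k).+1) => u v u0 v0 p1 p2 p3 p4 p5.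
by field; rewrite u0 v0 p1 p2 p3 p4 p5.
Qed.

Lemma sum_qpow_partial (t : nat -> K) n :
  (1 - q) * \sum_(0 <= j < n) q ^+ j * \sum_(0 <= k < j.+1) t k =
    \sum_(0 <= k < n) q ^+ k * t k - q ^+ n * \sum_(0 <= k < n) t k.
Proof.
elim: n => [|n IHn]; first by rewrite !big_nil !mulr0 subrr.
rewrite !(big_nat_recr n) //= mulrDr IHn exprS; ring.
Qed.

End ExactIdentities.

Lemma sum_sign (K : fieldType) m : \sum_(0 <= k < m) (-1) ^+ k = (odd m)%:R :> K.
Proof.
elim: m => [|m IHm]; first by rewrite big_nil.
rewrite big_nat_recr //= IHm -signr_odd.
by case: (odd m); rewrite ?subrr ?add0r.
Qed.

(** * The two sides of the congruences *)

Definition summand (K : fieldType) (q : K) n alpha k : K :=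
  q ^+ 'C(k + 1, 2) * qbinom q (alpha + k - 1) k
    * qbinom q (alpha + n - 1) (n - 1 - k).

Section RHS.
Variables (K : fieldType) (q : K).
Hypothesis q_nonroot : forall m, (0 < m)%N -> 1 - q ^+ m != 0.
Hypothesis q_neq0 : q != 0.

Lemma sum_sign_div_qint m :
  \sum_(1 <= k < m) (-1) ^+ k / qint q k =
    (1 - q) * \sum_(1 <= k < m) (-1) ^+ k / (1 - q ^+ k).
Proof.
rewrite mulr_sumr; apply: eq_bigr => k _.
by rewrite /qint invf_div mulrCA mulrA.
Qed.

(** (-q)^k / [k] = (-1)^k / [k] - (1 - q) (-1)^k, and an even number of alternating
    signs cancel. *)
Lemma sum_qsign_div_qint m : ~~ odd m ->
  \sum_(1 <= k < m.+1) (- q) ^+ k / qint q k =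
    \sum_(1 <= k < m.+1) (-1) ^+ k / qint q k.
Proof.
move=> m_even.
rewrite (eq_big_nat _ _ (F2 := fun k => (-1) ^+ k / qint q k - (1 - q) * (-1) ^+ k)).
  rewrite sumrB -mulr_sumr [X in _ - _ * X](_ : _ = 0) ?mulr0 ?subr0 //.
  apply: (addrI 1); rewrite addr0 -{1}[1](expr0 (-1)) -big_ltn //.
  by rewrite sum_sign /= m_even.
move=> k /andP[k_gt0 _]; have k0 := q_nonroot k_gt0.
have q1 := q_nonroot (ltn0Sn 0); rewrite expr1 in q1.
rewrite [(- q) ^+ k]exprNn /qint; move: (q ^+ k) ((-1) ^+ k) k0 => u e u0.
by field; rewrite u0 q1.
Qed.

Variable n alpha : nat.
Hypotheses (n_gt0 : (0 < n)%N) (alpha_gt0 : (0 < alpha)%N) (alpha_even : ~~ odd alpha).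

Definition residue1 : K :=
  2 * qint q n * (1 - q)
    + (2 * q ^+ alpha * qint q n - qint q alpha) / qint q alpha
    - 2 * qint q n * qfermat n 2 q
    - 2 * qint q n * \sum_(1 <= k < alpha.+1) (-1) ^+ k / qint q k.

Definition residue2 : K :=
  - qint q n
    - (qint q alpha - qint q n) / q ^+ alpha
    - (2 * qint q alpha * qint q n) / q ^+ alpha * qfermat n 2 q
    - (2 * qint q alpha * qint q n) / q ^+ alpha
        * \sum_(1 <= k < alpha.+1) (- q) ^+ k / qint q k.

(** The terms 2 [n] (1 - q) and 2 q^alpha [n] / [alpha] of the right-hand side only
    cancel the last term, k = alpha, of the alternating sum. *)
Lemma residue1E : residue1 =
  1 - 2 * qpoch (- q) q (n - 1)
    - 2 * (1 - q ^+ n) * \sum_(1 <= k < alpha) (-1) ^+ k / (1 - q ^+ k).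
Proof.
have q1 := q_nonroot (ltn0Sn 0); rewrite expr1 in q1.
have a0 := q_nonroot alpha_gt0.
rewrite /residue1 -(mulrA 2 _ (qfermat _ _ _)) qint_fermat // sum_sign_div_qint.
rewrite big_nat_recr //= -signr_odd (negPf alpha_even) expr0 /qint.
move: (\sum_(1 <= k < alpha) _) (q ^+ alpha) (q ^+ n) (qpoch _ _ _) a0.
by move=> s u v w u0; field; rewrite q1 u0.
Qed.

(** The right-hand sides are in the same relation as the two sums, see
    [cong_sum2]. *)
Lemma residue2E : q ^+ alpha * ((1 - q) * residue2) =
  (1 - q ^+ alpha) * residue1 - (1 + q ^+ alpha) * (1 - q ^+ n).
Proof.
have q1 := q_nonroot (ltn0Sn 0); rewrite expr1 in q1.
have a0 := q_nonroot alpha_gt0; have u0 : q ^+ alpha != 0 by rewrite expf_neq0.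
rewrite /residue2 /residue1 sum_qsign_div_qint //.
move: (\sum_(1 <= k < alpha.+1) _) (qfermat _ _ _) => s f.
rewrite /qint; move: (q ^+ alpha) (q ^+ n) a0 u0 => u v a0 u0.
by field; rewrite q1 a0 u0.
Qed.
End RHS.

(** * Congruences modulo powers of the cyclotomic polynomial *)

(** The properties of divisibility by powers of Phi_n that the computation rests
    on, for an abstract q: V i stands for the multiples of Phi_n^i among the
    fractions that are integral at Phi_n. *)
Record cyclotomic_filtration (K : fieldType) (q : K) (n : nat)
    (V : nat -> K -> Prop) : Prop := CyclotomicFiltration {
  cfilt0 : forall i, V i 0;
  cfilt1 : V 0%N 1;
  cfiltD : forall i x y, V i x -> V i y -> V i (x + y);
  cfiltN : forall i x, V i x -> V i (- x);
  cfiltM : forall i j x y, V i x -> V j y -> V (i + j)%N (x * y);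
  cfiltW : forall i x, V i.+1 x -> V i x;
  cfilt_q : V 0%N q;
  cfilt_qV : V 0%N q^-1;
  cfilt_1subqXV : forall k, ~~ (n %| k)%N -> V 0%N (1 - q ^+ k)^-1;
  cfilt_1subqXn : V 1%N (1 - q ^+ n) }.

Section Congruences.
Variables (K : fieldType) (q : K) (p : nat) (V : nat -> K -> Prop).
Let n := p.+1.
Hypothesis q_nonroot : forall m, (0 < m)%N -> 1 - q ^+ m != 0.
Hypothesis q_neq0 : q != 0.
Hypothesis Vfilt : cyclotomic_filtration q n V.

Local Notation "x =[ i ]= y" := (V i%N (x - y)) (at level 70, i at level 0).

Let V0 := cfilt0 Vfilt.
Let VD := cfiltD Vfilt.
Let VN := cfiltN Vfilt.

Lemma cfiltMl i x y : V 0%N x -> V i y -> V i (x * y).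
Proof. exact: cfiltM Vfilt 0%N i x y. Qed.

Lemma cfilt_le0 i x : V i x -> V 0%N x.
Proof. by elim: i => // i IHi /(cfiltW Vfilt). Qed.

Lemma cfiltX x k : V 0%N x -> V 0%N (x ^+ k).
Proof.
move=> Vx; elim: k => [|k IHk]; first exact: cfilt1 Vfilt.
by rewrite exprS; apply: cfiltMl.
Qed.

Lemma cfilt_nat m : V 0%N m%:R.
Proof.
elim: m => [|m IHm]; first exact: V0.
by rewrite -natr1; apply: VD IHm (cfilt1 Vfilt).
Qed.

Lemma cfilt_sign k : V 0%N ((-1) ^+ k).
Proof. by apply/cfiltX/VN/(cfilt1 Vfilt). Qed.

Lemma cfilt_qX k : V 0%N (q ^+ k).
Proof. exact/cfiltX/(cfilt_q Vfilt). Qed.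

Lemma cfilt_1subqX k : V 0%N (1 - q ^+ k).
Proof. exact: VD (cfilt1 Vfilt) (VN (cfilt_qX k)). Qed.

Lemma cfilt_unit k : (0 < k < n)%N -> V 0%N (1 - q ^+ k)^-1.
Proof.
by move=> /andP[k0 kn]; apply: (cfilt_1subqXV Vfilt); rewrite gtnNdvd.
Qed.

Lemma cfilt_sum i r (F : nat -> K) :
  (forall k, k \in r -> V i (F k)) -> V i (\sum_(k <- r) F k).
Proof.
by move=> VF; rewrite big_seq; apply: (big_ind (V i)) => //; apply: VD.
Qed.

Lemma cong_refl i x : x =[i]= x.
Proof. by rewrite subrr. Qed.

Lemma cong_trans i y x z : x =[i]= y -> y =[i]= z -> x =[i]= z.
Proof. by move=> xy /(VD xy); rewrite addrA subrK. Qed.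

Lemma congD i x x' y y' : x =[i]= x' -> y =[i]= y' -> x + y =[i]= x' + y'.
Proof. by move=> xx' yy'; rewrite opprD addrACA; apply: VD. Qed.

Lemma congN i x x' : x =[i]= x' -> - x =[i]= - x'.
Proof. by move=> /VN; rewrite opprD. Qed.

Lemma congMl i c x y : V 0%N c -> x =[i]= y -> c * x =[i]= c * y.
Proof. by move=> Vc xy; rewrite -mulrBr; apply: cfiltMl. Qed.

Lemma congM i x x' y y' :
  V 0%N x' -> V 0%N y -> x =[i]= x' -> y =[i]= y' -> x * y =[i]= x' * y'.
Proof.
move=> Vx' Vy xx' yy'; apply: (@cong_trans i (x' * y)).
  by rewrite ![_ * y]mulrC; apply: congMl.
exact: congMl.
Qed.

Lemma cong_sum i a b F G :
  (forall k, (a <= k < b)%N -> F k =[i]= G k) ->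
  \sum_(a <= k < b) F k =[i]= \sum_(a <= k < b) G k.
Proof.
move=> FG; rewrite -sumrB; apply: cfilt_sum => k.
by rewrite mem_index_iota; apply: FG.
Qed.

Lemma cong_cfilt0 i x y : x =[i]= y -> V 0%N y -> V 0%N x.
Proof. by move=> /cfilt_le0 xy Vy; rewrite -(subrK y x); apply: VD. Qed.

Lemma cfilt1_mul_1subqXn x : V 0%N x -> V 1%N ((1 - q ^+ n) * x).
Proof. exact: cfiltM Vfilt 1%N 0%N _ x (cfilt_1subqXn Vfilt). Qed.

(** The common factor 1 - q^n of the summands is why congruences modulo Phi_n
    suffice for all but one of them. *)
Lemma cong_1subqXn x y : x =[1]= y -> (1 - q ^+ n) * x =[2]= (1 - q ^+ n) * y.
Proof. by rewrite -mulrBr; apply: (cfiltM Vfilt) (cfilt_1subqXn Vfilt). Qed.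

(** By induction on k: going from k to k + 1 multiplies the left-hand side by
    (q^(k+1) - q^n) / (1 - q^(k+1)), which is -1 when q^n = 1. *)
Lemma cong_qbinom_pred k : (k < n)%N ->
  q ^+ 'C(k.+1, 2) * qbinom q p k =[1]= (-1) ^+ k.
Proof.
elim: k => [|k IHk] lt_kn; first by rewrite qbinom0 // mulr1; apply: cong_refl.
have IH := IHk (ltnW lt_kn).
apply: (@cong_trans _ (- (q ^+ 'C(k.+1, 2) * qbinom q p k))); last first.
  by rewrite exprS mulN1r; apply: congN.
have k0 := q_nonroot (ltn0Sn k).
have ->: qbinom q p k.+1 = qbinom q p k * (1 - q ^+ (p - k)) / (1 - q ^+ k.+1).
  by rewrite -mul_qbinomSr ?mulfK // -ltnS ltnW.
have eqn: q ^+ n = q ^+ (p - k) * q ^+ k.+1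
  by rewrite -exprD addnS subnK // -ltnS ltnW.
rewrite opprK [X in V 1%N X](_ : _ =
  (1 - q ^+ n) * ((q ^+ 'C(k.+1, 2) * qbinom q p k) * (1 - q ^+ k.+1)^-1)).
  apply: cfilt1_mul_1subqXn.
  apply: cfiltMl; last by apply: cfilt_unit.
  exact: cong_cfilt0 IH (cfilt_sign k).
rewrite binS bin1 addnC exprD eqn.
move: (q ^+ 'C(_, _)) (q ^+ (p - k)) (q ^+ k.+1) (qbinom q p k) k0 => u v w b w0.
by field.
Qed.

(** By induction on a: the factor gained is (1 - q^(n+a+1)) / (1 - q^(a+1)). *)
Lemma cong_qbinom_add a : (a < n)%N -> qbinom q (n + a) a =[1]= 1.
Proof.
elim: a => [|a IHa] lt_an; first by rewrite qbinom0 //; apply: cong_refl.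
have IH := IHa (ltnW lt_an); apply: cong_trans (IH).
have a0 := q_nonroot (ltn0Sn a).
have ->: qbinom q (n + a.+1) a.+1 =
    qbinom q (n + a) a * (1 - q ^+ (n + a.+1)) / (1 - q ^+ a.+1).
  by rewrite addnS -mul_qbinomSS ?mulfK // leq_addl.
rewrite [X in V 1%N X](_ : _ =
  (1 - q ^+ n) * (qbinom q (n + a) a * q ^+ a.+1 * (1 - q ^+ a.+1)^-1)).
  apply: cfilt1_mul_1subqXn.
  apply: cfiltMl; last by apply: cfilt_unit.
  by apply: cfiltMl (cfilt_qX _); apply: cong_cfilt0 IH (cfilt1 Vfilt).
rewrite exprD; move: (q ^+ n) (q ^+ a.+1) (qbinom _ _ _) a0 => u v b v0.
by field.
Qed.

(** Neither binomial is determined modulo Phi_n^2 by its value modulo Phi_n, but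
    their product is.  With i = a + 1, going from a to i multiplies the left-hand
    side by q^(i-n) (1 - q^(n+i)) (1 - q^(n-i)) / (1 - q^i)^2, and
      (1 - q^(n+i)) (1 - q^(n-i)) + q^(n-i) (1 - q^i)^2 = (1 - q^n)^2,
    so that this factor is -1 up to a multiple of the square of 1 - q^n. *)
Lemma cong_exceptional a : (a < n)%N ->
  q ^+ 'C(n - a, 2) * qbinom q (n + a) a * qbinom q p a
    =[2]= (-1) ^+ a * q ^+ 'C(n, 2).
Proof.
elim: a => [|a IHa] lt_an.
  by rewrite !qbinom0 // subn0 !mulr1 mul1r; apply: cong_refl.
have IH := IHa (ltnW lt_an).
rewrite exprS mulN1r mulNr; apply: cong_trans (congN IH).
have a0 := q_nonroot (ltn0Sn a).
have ->: qbinom q (n + a.+1) a.+1 =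
    qbinom q (n + a) a * (1 - q ^+ (n + a.+1)) / (1 - q ^+ a.+1).
  by rewrite addnS -mul_qbinomSS ?mulfK // leq_addl.
have ->: qbinom q p a.+1 = qbinom q p a * (1 - q ^+ (p - a)) / (1 - q ^+ a.+1).
  by rewrite -mul_qbinomSr ?mulfK // -ltnS ltnW.
have eqn: q ^+ n = q ^+ (p - a) * q ^+ a.+1
  by rewrite -exprD addnS subnK // -ltnS ltnW.
have Vu := cong_cfilt0 IH (cfiltMl (cfilt_sign a) (cfilt_qX _)).
have vV: V 0%N (q ^+ (p - a))^-1 by rewrite -exprVn; apply/cfiltX/(cfilt_qV Vfilt).
have v0: q ^+ (p - a) != 0 by rewrite expf_neq0.
rewrite opprK [X in V 2%N X](_ : _ = (1 - q ^+ n) * ((1 - q ^+ n) *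
  (q ^+ 'C(n - a, 2) * qbinom q (n + a) a * qbinom q p a
     * (q ^+ (p - a))^-1 * (1 - q ^+ a.+1)^-1 * (1 - q ^+ a.+1)^-1))).
  apply: (cfiltM Vfilt (i := 1%N) (j := 1%N)); first exact: cfilt_1subqXn Vfilt.
  apply: cfilt1_mul_1subqXn.
  have aV: V 0%N (1 - q ^+ a.+1)^-1 by apply: cfilt_unit.
  by do 3?apply: cfiltMl.
have ->: (n - a = (p - a).+1)%N by rewrite subSn // -ltnS ltnW.
rewrite subSS binS bin1 !exprD eqn.
move: (q ^+ 'C(_, _)) (q ^+ (p - a)) (q ^+ a.+1) (qbinom _ _ _) (qbinom _ _ _) a0 v0.
move=> u v w b c w0 v0.
by field; rewrite v0 w0.
Qed.

Hypothesis p_even : ~~ odd p.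

Lemma qpoch_NqE : qpoch (- q) q p =
  \sum_(0 <= k < n) q ^+ 'C(k.+1, 2) * qbinom q p k.
Proof.
rewrite -qbinomial_theorem //; apply: eq_bigr => k _.
by rewrite binS bin1 exprD.
Qed.

(** The signs (-1)^k of [cong_qbinom_pred] add up to 1 over k < n, as n is odd. *)
Lemma cong_qpoch_Nq : qpoch (- q) q p =[1]= 1.
Proof.
have ->: 1 = \sum_(0 <= k < n) (-1) ^+ k :> K by rewrite sum_sign /= p_even.
rewrite qpoch_NqE.
by apply: cong_sum => k /andP[_]; apply: cong_qbinom_pred.
Qed.

Local Notation h k := ((-1) ^+ k / (1 - q ^+ k)).

(** In the q-binomial expansion of (-1; q)_n the two extreme terms are 1 and
    q^C(n,2); the others contain [n, k] = [n-1, k-1] (1 - q^n) / (1 - q^k). *)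
Lemma cong_fermat :
  2 * qpoch (- q) q p =[2]=
    1 + q ^+ 'C(n, 2) - (1 - q ^+ n) * \sum_(1 <= k < n) h k.
Proof.
have ->: 2 * qpoch (- q) q p = 2 * qpoch (- q) q (n - 1) by rewrite subn1.
rewrite -qpoch_N1 // -qbinomial_theorem // big_nat_recr //= big_nat_recl //=.
rewrite qbinom0 // qbinomn // expr0 expr1n !mulr1 addrAC.
apply: congD; first exact: cong_refl.
rewrite big_add1 /= -mulrN -sumrN mulr_sumr.
apply: cong_sum => k /andP[_ lt_kp].
have k0 := q_nonroot (ltn0Sn k).
have ->: qbinom q n k.+1 = qbinom q p k * (1 - q ^+ n) / (1 - q ^+ k.+1).
  by rewrite -mul_qbinomSS ?mulfK // ltnW.
rewrite [X in V 2%N (X - _)](_ : _ = (1 - q ^+ n) *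
  ((1 - q ^+ k.+1)^-1 * (q ^+ 'C(k.+1, 2) * qbinom q p k))); last first.
  by rewrite expr1n; ring.
rewrite [(-1) ^+ k.+1]exprS mulN1r mulNr opprK [(-1) ^+ k / _]mulrC.
apply/cong_1subqXn/congMl.
  by apply: cfilt_unit.
exact/cong_qbinom_pred/ltnW.
Qed.

Variable a : nat.
Hypotheses (a_odd : odd a) (lt_an : (a.+1 < n)%N).

Local Notation t k := (summand q n a.+1 k).
Local Notation S1 := (\sum_(0 <= k < n) t k).
Local Notation S2 := (\sum_(0 <= j < n) q ^+ j * \sum_(0 <= k < j.+1) t k).

Lemma summand_factored k : (k < n)%N ->
  t k = (1 - q ^+ n) *
    (qbinom q (n + a) a * (q ^+ 'C(k.+1, 2) * qbinom q p k) / (1 - q ^+ (a.+1 + k))).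
Proof.
move=> lt_kn; rewrite /summand !addSn !subSS !subn0 -mulrA.
have := qbinom_mul_factored q_nonroot a lt_kn; rewrite !subSS subn0 => ->.
by rewrite addn1; ring.
Qed.

Lemma cong_summand k : (k < n)%N -> (a.+1 + k != n)%N ->
  t k =[2]= (1 - q ^+ n) * ((-1) ^+ k / (1 - q ^+ (a.+1 + k))).
Proof.
move=> lt_kn neq_n; rewrite summand_factored //; apply: cong_1subqXn.
have lt_a := ltnW lt_an.
have Vinv : V 0%N (1 - q ^+ (a.+1 + k))^-1.
  apply: (cfilt_1subqXV Vfilt); apply/negP=> /dvdnP[c eq_c].
  case: c eq_c => [|[|c]]; rewrite ?mul0n ?mul1n //; first by move/eqP: neq_n.
  by rewrite !mulSn; lia.
rewrite ![_ / _]mulrC; apply: congMl => //; rewrite -[(-1) ^+ k]mul1r.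
have cb := cong_qbinom_pred lt_kn.
apply: congM => //; first exact: cfilt1 Vfilt.
- exact: cong_cfilt0 cb (cfilt_sign k).
- exact: cong_qbinom_add.
Qed.

(** At k = p - a the denominator 1 - q^(a+1+k) is 1 - q^n itself and cancels the
    common factor, so that the binomials are needed modulo Phi_n^2. *)
Lemma cong_summand_exceptional : t (p - a) =[2]= - q ^+ 'C(n, 2).
Proof.
have lt_a := ltnW lt_an; have le_ap: (a <= p)%N by rewrite -ltnS.
rewrite summand_factored; last by rewrite ltnS leq_subr.
have ->: (a.+1 + (p - a) = n)%N by rewrite addSn subnKC.
have n0 := q_nonroot (ltn0Sn p).
rewrite qbinom_sym // [X in V 2%N X](_ : _ = q ^+ 'C(n - a, 2) *
    qbinom q (n + a) a * qbinom q p a - (-1) ^+ a * q ^+ 'C(n, 2)).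
  exact: cong_exceptional.
rewrite -signr_odd a_odd expr1 mulN1r -subSn // -/n.
by congr (_ - _); rewrite mulrC divfK //; ring.
Qed.

(** The summands below k = p - a contribute the h_m with m = a + 1 + k < n.  Those
    above have a + 1 + k = n + i with 1 <= i <= a; as a and n are odd, each of
    them contributes - h_i.  The second kind is thus minus the part that the first
    kind lacks of the complete sum, which explains the coefficient 2. *)
Lemma cong_sum1 :
  S1 =[2]= - q ^+ 'C(n, 2) + (1 - q ^+ n) *
    (\sum_(1 <= k < n) h k - 2 * \sum_(1 <= k < a.+1) h k).
Proof.
have le_ap: (a <= p)%N by rewrite -ltnS ltnW.
rewrite (@big_cat_nat _ _ _ (p - a)) //=; last by rewrite leqW ?leq_subr.
rewrite [\sum_(p - a <= k < n) _]big_ltn; last by rewrite ltnS leq_subr.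
rewrite addrCA; apply: congD; first exact: cong_summand_exceptional.
rewrite [\sum_(1 <= k < n) _](@big_cat_nat _ _ _ a.+1) //=.
rewrite [X in (1 - q ^+ n) * X](_ : _ = \sum_(a.+1 <= k < n) h k
  + \sum_(1 <= k < a.+1) - h k); last by rewrite sumrN; ring.
rewrite mulrDr; apply: congD.
  have ->: \sum_(a.+1 <= k < n) h k = \sum_(0 <= k < p - a) h (k + a.+1).
    by rewrite -{1}[a.+1]add0n big_addn subSS.
  rewrite mulr_sumr.
  apply: cong_sum => k /andP[_ lt_k].
  have ->: (-1) ^+ (k + a.+1) = (-1) ^+ k :> K.
    by rewrite exprD -[X in _ * X]signr_odd /= a_odd mulr1.
  by rewrite [(k + _)%N]addnC; apply: cong_summand; lia.
have ->: \sum_((p - a).+1 <= k < n) t k = \sum_(1 <= k < a.+1) t (k + (p - a)).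
  by rewrite -{1}[(p - a).+1]add1n big_addn subSn ?leq_subr // subKn.
rewrite mulr_sumr; apply: cong_sum => k /andP[k_gt0 le_ka].
apply: cong_trans (cong_summand _ _) _; [lia | lia |].
apply: cong_1subqXn.
have ->: (-1) ^+ (k + (p - a)) = - (-1) ^+ k :> K.
  by rewrite exprD -[X in _ * X]signr_odd oddB // a_odd (negPf p_even) mulrN1.
have ->: (a.+1 + (k + (p - a)) = n + k)%N by lia.
rewrite mulNr; apply/congN/congMl; first exact: cfilt_sign.
have n0: 1 - q ^+ (n + k) != 0 by apply: q_nonroot.
have k0 := q_nonroot k_gt0.
rewrite [X in V 1%N X](_ : _ = (1 - q ^+ n) *
  (- q ^+ k * (1 - q ^+ (n + k))^-1 * (1 - q ^+ k)^-1)).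
  apply: cfilt1_mul_1subqXn.
  apply: cfiltMl; last by apply: cfilt_unit; lia.
  apply: cfiltMl; first exact/VN/cfilt_qX.
  apply: (cfilt_1subqXV Vfilt); rewrite dvdn_addr // gtnNdvd //; lia.
move: n0; rewrite exprD; move: (q ^+ n) (q ^+ k) k0 => u v v0 uv0.
by field; rewrite uv0 v0.
Qed.

Lemma cong_sum1_qpoch :
  S1 =[2]= 1 - 2 * qpoch (- q) q p - 2 * (1 - q ^+ n) * \sum_(1 <= k < a.+1) h k.
Proof.
apply: cong_trans cong_sum1 _.
have := congN cong_fermat; rewrite -opprD => /VN.
rewrite !opprK; congr (V 2%N _); ring.
Qed.

Lemma cong_sum1_m1 : S1 =[1]= - 1.
Proof.
apply: cong_trans (cfiltW Vfilt cong_sum1_qpoch) _.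
rewrite [X in V 1%N X](_ : _ = - 2 * (qpoch (- q) q p - 1) - (1 - q ^+ n) *
  (2 * \sum_(1 <= k < a.+1) h k)); last by ring.
apply: VD; first by apply: cfiltMl cong_qpoch_Nq; apply/VN/(cfilt_nat 2).
apply/VN; apply: cfilt1_mul_1subqXn.
apply: cfiltMl; first exact: (cfilt_nat 2).
apply: cfilt_sum => k; rewrite mem_index_iota => /andP[k_gt0 le_ka].
by apply: cfiltMl (cfilt_sign _) (cfilt_unit _); lia.
Qed.

(** Summation by parts, then q^(a+1+k) = 1 - (1 - q^(a+1+k)) in each summand: the
    second term cancels the denominator of the summand and leaves a q-binomial
    expansion of (-q; q)_p. *)
Lemma sum2E : q ^+ a.+1 * ((1 - q) * S2) =
  (1 - q ^+ (n + a.+1)) * S1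
    - (1 - q ^+ n) * (qbinom q (n + a) a * qpoch (- q) q p).
Proof.
rewrite sum_qpow_partial mulrBr mulr_sumr.
rewrite (eq_big_nat _ _ (F2 := fun k => t k -
  (1 - q ^+ n) * qbinom q (n + a) a * (q ^+ 'C(k.+1, 2) * qbinom q p k))).
  by rewrite sumrB -mulr_sumr -qpoch_NqE exprD; ring.
move=> k /andP[_ lt_kn]; rewrite mulrA -exprD summand_factored //.
have k0: 1 - q ^+ (a.+1 + k) != 0 by apply: q_nonroot.
move: (q ^+ (a.+1 + k)) (q ^+ n) (q ^+ 'C(_, _)) (qbinom _ _ _) (qbinom _ _ _) k0.
by move=> u v w b c u0; field.
Qed.

(** Write 1 - q^(n+a+1) = (1 - q^(a+1)) + q^(a+1) (1 - q^n) in the exact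
    formula: next to 1 - q^n, only the values modulo Phi_n matter, and these are
    S1 = -1, [n+a, a] = 1 and (-q; q)_p = 1. *)
Lemma cong_sum2 : q ^+ a.+1 * ((1 - q) * S2) =[2]=
  (1 - q ^+ a.+1) * S1 - (1 + q ^+ a.+1) * (1 - q ^+ n).
Proof.
rewrite sum2E [X in V 2%N X](_ : _ =
   q ^+ a.+1 * ((1 - q ^+ n) * S1 - (1 - q ^+ n) * - 1)
   - ((1 - q ^+ n) * (qbinom q (n + a) a * qpoch (- q) q p) - (1 - q ^+ n) * 1)).
  apply: VD; first exact/(cfiltMl (cfilt_qX _))/cong_1subqXn/cong_sum1_m1.
  apply/VN/cong_1subqXn; rewrite -[X in _ =[1]= X]mulr1.
  apply: congM; first exact: cfilt1 Vfilt.
  - exact: cong_cfilt0 cong_qpoch_Nq (cfilt1 Vfilt).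
  - exact/cong_qbinom_add/ltnW.
  exact: cong_qpoch_Nq.
by rewrite exprD; ring.
Qed.

End Congruences.

Lemma cong_sums (K : fieldType) (q : K) (V : nat -> K -> Prop) n alpha :
  (forall m, (0 < m)%N -> 1 - q ^+ m != 0) -> q != 0 ->
  cyclotomic_filtration q n V ->
  odd n -> (0 < alpha)%N -> ~~ odd alpha -> (alpha < n)%N ->
  V 2%N (\sum_(0 <= k < n) summand q n alpha k - residue1 q n alpha) /\
  V 2%N (\sum_(0 <= j < n) q ^+ j * \sum_(0 <= k < j.+1) summand q n alpha k
         - residue2 q n alpha).
Proof.
move=> q_nonroot q_neq0; case: n => // p Vf p_even.
case: alpha => // a a_gt0 a_odd lt_an.
have c1 := cong_sum1_qpoch q_nonroot q_neq0 Vf p_even (negbNE a_odd) lt_an.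
have c2 := cong_sum2 q_nonroot q_neq0 Vf p_even (negbNE a_odd) lt_an.
have e1 := residue1E q_nonroot (ltn0Sn p) a_gt0 a_odd.
have e2 := residue2E q_nonroot q_neq0 p.+1 a_gt0 a_odd.
rewrite subn1 /= in e1; rewrite -e1 in c1; split=> //.
have q1 : 1 - q != 0 by have := q_nonroot _ (ltn0Sn 0); rewrite expr1.
have qa0 : q ^+ a.+1 != 0 by rewrite expf_neq0.
set S := \sum_(_ <= _ < _) _ in c2 *.
have ->: S - residue2 q p.+1 a.+1 = (q ^+ a.+1)^-1 * ((1 - q)^-1 *
    (q ^+ a.+1 * ((1 - q) * S) - q ^+ a.+1 * ((1 - q) * residue2 q p.+1 a.+1))).
  move: (q ^+ _) qa0 => u u0.
  by field; rewrite q1 u0.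
apply: (cfiltMl Vf); first by rewrite -exprVn; apply/(cfiltX Vf)/(cfilt_qV Vf).
apply: (cfiltMl Vf).
  by rewrite -(expr1 q); apply: (cfilt_unit Vf); lia.
rewrite e2; apply: (cong_trans Vf) c2 _.
apply: (congD Vf); last exact: cong_refl Vf _ _.
exact: (congMl Vf) (cfilt_1subqX Vf _) c1.
Qed.

(** * The localization of Z[q] at the primitive roots of unity *)

Lemma polyfracM A B : polyfrac (A * B) = polyfrac A * polyfrac B.
Proof. exact: tofracM. Qed.

Lemma polyfracD A B : polyfrac (A + B) = polyfrac A + polyfrac B.
Proof. exact: tofracD. Qed.

Lemma polyfracX A k : polyfrac (A ^+ k) = polyfrac A ^+ k.
Proof. exact: tofracXn. Qed.

Lemma polyfrac_eq0 A : (polyfrac A == 0) = (A == 0).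
Proof. exact: tofrac_eq0. Qed.

Lemma polyfrac_1subX k : polyfrac (1 - 'X^k) = 1 - qX ^+ k.
Proof. by rewrite /polyfrac tofracB tofrac1 tofracXn. Qed.

Lemma qX_nonroot k : (0 < k)%N -> 1 - qX ^+ k != 0.
Proof.
move=> k_gt0; rewrite -polyfrac_1subX polyfrac_eq0 -oppr_eq0 opprB.
exact/monic_neq0/monicXnsubC.
Qed.

Lemma ratfun_qX_neq0 : qX != 0.
Proof. by rewrite polyfrac_eq0 polyX_eq0. Qed.

(** The polynomials that may serve as denominators in a congruence modulo a power
    of Phi_n: those prime to Phi_n over Q.  Evaluation at the complex roots makes
    closure under products immediate. *)
Definition nonvanishing n (B : {poly int}) :=
  forall z : algC, n.-primitive_root z -> (map_poly intr B).[z] != 0.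

(** The i-th power of the ideal generated by Phi_n in the ring obtained from Z[q]
    by inverting the nonvanishing polynomials; i = 0 is that ring itself. *)
Definition vanishes n i (x : ratfun) :=
  exists A B, nonvanishing n B /\ x = polyfrac ('Phi_n ^+ i * A) / polyfrac B.

Section Vanishing.
Variable n : nat.
Hypothesis n_gt0 : (0 < n)%N.

Lemma nonvanishingM A B :
  nonvanishing n A -> nonvanishing n B -> nonvanishing n (A * B).
Proof.
by move=> nvA nvB z pz; rewrite rmorphM hornerM mulf_neq0 ?nvA ?nvB.
Qed.

Lemma nonvanishing1 : nonvanishing n 1.
Proof. by move=> z _; rewrite rmorph1 hornerC oner_eq0. Qed.

Lemma nonvanishing_neq0 B : nonvanishing n B -> B != 0.
Proof.
have [z pz] := C_prim_root_exists n_gt0.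
by move/(_ z pz); apply: contraNneq => ->; rewrite rmorph0 horner0.
Qed.

Lemma polyfrac_nonvanishing B : nonvanishing n B -> polyfrac B != 0.
Proof. by rewrite polyfrac_eq0; apply: nonvanishing_neq0. Qed.

Lemma root_Cyclotomic (z : algC) :
  root (map_poly intr 'Phi_n) z = n.-primitive_root z.
Proof.
have [w pw] := C_prim_root_exists n_gt0.
by rewrite (Cintr_Cyclotomic pw) (root_cyclotomic pw).
Qed.

(** A common divisor D of B and Phi_n^i has a unit as leading coefficient, because
    it divides a monic polynomial.  A complex root of D would be a primitive n-th
    root of unity at which B vanishes; so D has none, and is constant. *)
Lemma nonvanishing_coprime B i : nonvanishing n B -> zcoprime B ('Phi_n ^+ i).
Proof.
move=> nvB D [E1 defB] [E2 defPhi].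
have unit_lead : lead_coef D \is a GRing.unit.
  have: lead_coef E2 * lead_coef D = 1.
    by rewrite -lead_coefM -defPhi; apply/monicP/monic_exp/Cyclotomic_monic.
  by move=> eq1; apply/unitrP; exists (lead_coef E2); rewrite eq1 mulrC eq1.
suff: size D == 1%N.
  move=> size1; rewrite poly_unitE size1.
  by move: unit_lead; rewrite lead_coefE (eqP size1).
rewrite -(size_map_inj_poly (intr_inj : injective (intr : int -> algC))) //.
apply/negP=> /negP/closed_rootP[z Dz].
have /nvB : n.-primitive_root z.
  rewrite -root_Cyclotomic.
  have: root (map_poly intr ('Phi_n ^+ i)) z.
    by rewrite defPhi rmorphM rootM Dz orbT.
  by rewrite rmorphXn !rootE horner_exp expf_eq0 => /andP[].
by rewrite defB rmorphM hornerM (rootP Dz) mulr0 eqxx.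
Qed.

Lemma vanishes_eq0_mod i x : vanishes n i x -> ratfun_eq0_mod ('Phi_n ^+ i) x.
Proof.
move=> [A [B [nvB ->]]]; exists ('Phi_n ^+ i * A), B; split=> //.
- exact: nonvanishing_neq0.
- by exists A; rewrite mulrC.
exact: nonvanishing_coprime.
Qed.

Lemma vanishesD i x y : vanishes n i x -> vanishes n i y -> vanishes n i (x + y).
Proof.
move=> [A [B [nvB ->]]] [A' [B' [nvB' ->]]].
exists (A * B' + A' * B), (B * B'); split; first exact: nonvanishingM.
have b0 := polyfrac_nonvanishing nvB; have b0' := polyfrac_nonvanishing nvB'.
rewrite (addf_div _ _ b0 b0') -!polyfracM -polyfracD.
by congr (polyfrac _ / _); rewrite mulrDr !mulrA.
Qed.

Lemma vanishesM i j x y :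
  vanishes n i x -> vanishes n j y -> vanishes n (i + j) (x * y).
Proof.
move=> [A [B [nvB ->]]] [A' [B' [nvB' ->]]].
exists (A * A'), (B * B'); split; first exact: nonvanishingM.
have b0 := polyfrac_nonvanishing nvB; have b0' := polyfrac_nonvanishing nvB'.
by rewrite mulf_div -!polyfracM exprD mulrACA.
Qed.

Lemma vanishes_polyfrac A : vanishes n 0 (polyfrac A).
Proof.
exists A, 1; split; first exact: nonvanishing1.
by rewrite mul1r [polyfrac 1]tofrac1 divr1.
Qed.

Lemma vanishes_inv B : nonvanishing n B -> vanishes n 0 (polyfrac B)^-1.
Proof.
by move=> nvB; exists 1, B; rewrite mulr1 [polyfrac 1]tofrac1 mul1r; split.
Qed.

Lemma vanishes0 i : vanishes n i 0.
Proof.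
exists 0, 1; split; first exact: nonvanishing1.
by rewrite mulr0 [polyfrac 0]tofrac0 mul0r.
Qed.

Lemma vanishesN i x : vanishes n i x -> vanishes n i (- x).
Proof.
move=> vx; rewrite -mulN1r; apply: (@vanishesM 0 i) vx.
by rewrite -tofrac1 -tofracN; apply: vanishes_polyfrac.
Qed.

Lemma vanishes_qX k : vanishes n 0 (qX ^+ k).
Proof. by rewrite /qX -polyfracX; apply: vanishes_polyfrac. Qed.

Lemma vanishes_qXV k : vanishes n 0 (qX ^+ k)^-1.
Proof.
rewrite /qX -polyfracX; apply: vanishes_inv => z pz.
rewrite map_polyXn hornerXn expf_neq0 //; apply: contraTneq pz => ->.
apply/negP=> /prim_expr_order/eqP.
by rewrite expr0n eqn0Ngt n_gt0 eq_sym oner_eq0.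
Qed.

Lemma vanishes_1subqXV k : ~~ (n %| k)%N -> vanishes n 0 (1 - qX ^+ k)^-1.
Proof.
move=> n_ndv_k; rewrite -polyfrac_1subX; apply: vanishes_inv => z pz.
rewrite rmorphB rmorph1 /= map_polyXn hornerD hornerN hornerC hornerXn.
by rewrite subr_eq0 eq_sym -(prim_order_dvd pz).
Qed.

Lemma vanishes_1subqXn : vanishes n 1 (1 - qX ^+ n).
Proof.
exists (- \prod_(d <- rem n (divisors n)) 'Phi_d), 1; split.
  exact: nonvanishing1.
rewrite [polyfrac 1]tofrac1 divr1 expr1 mulrN -polyfrac_1subX; congr polyfrac.
by rewrite -opprB -(prod_Cyclotomic n_gt0) (big_rem n) //= -dvdn_divisors.
Qed.

End Vanishing.

Lemma vanishes_cyclotomic_filtration n :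
  (0 < n)%N -> cyclotomic_filtration qX n (vanishes n).
Proof.
move=> n_gt0; split.
- exact: vanishes0.
- exact: (vanishes_qX n 0).
- exact: vanishesD.
- exact: vanishesN.
- exact: vanishesM.
- move=> i x [A [B [nvB ->]]]; exists ('Phi_n * A), B; split=> //.
  by rewrite mulrA -exprSr.
- exact: (vanishes_qX n 1).
- have := vanishes_qXV n_gt0 1; by rewrite expr1.
- exact: vanishes_1subqXV.
exact: vanishes_1subqXn.
Qed.

(** * The theorem for rational functions *)

Theorem theorem1p1 (n alpha : nat) :
  (0 < n)%N -> odd n ->
  (0 < alpha)%N -> ~~ odd alpha -> (alpha <= n)%N ->
  ratfun_eq_mod ('Phi_n ^+ 2)
    (\sum_(0 <= k < n)
        qX ^+ 'C(k + 1, 2) * qbinom qX (alpha + k - 1) k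
          * qbinom qX (alpha + n - 1) (n - 1 - k))
    (2 * qint qX n * (1 - qX)
       + (2 * qX ^+ alpha * qint qX n - qint qX alpha) / qint qX alpha
       - 2 * qint qX n * qfermat n 2 qX
       - 2 * qint qX n * \sum_(1 <= k < alpha.+1) (-1) ^+ k / qint qX k)
  /\
  ratfun_eq_mod ('Phi_n ^+ 2)
    (\sum_(0 <= j < n) qX ^+ j *
        \sum_(0 <= k < j.+1)
          qX ^+ 'C(k + 1, 2) * qbinom qX (alpha + k - 1) k
            * qbinom qX (alpha + n - 1) (n - 1 - k))
    (- qint qX n
       - (qint qX alpha - qint qX n) / qX ^+ alpha
       - (2 * qint qX alpha * qint qX n) / qX ^+ alpha * qfermat n 2 qX
       - (2 * qint qX alpha * qint qX n) / qX ^+ alpha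
           * \sum_(1 <= k < alpha.+1) (- qX) ^+ k / qint qX k).
Proof.
move=> n_gt0 n_odd alpha_gt0 alpha_even le_an.
have lt_an : (alpha < n)%N.
  by rewrite ltn_neqAle le_an andbT; apply: contraNneq alpha_even => ->.
have [c1 c2] := cong_sums qX_nonroot ratfun_qX_neq0
  (vanishes_cyclotomic_filtration n_gt0) n_odd alpha_gt0 alpha_even lt_an.
split; rewrite /ratfun_eq_mod.
  exact (vanishes_eq0_mod n_gt0 c1).
exact (vanishes_eq0_mod n_gt0 c2).
Qed.
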